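(* Let $R$ be a simple ring such that the right module $R_R$ is ADS. Then either $R_R$ is indecomposable (as a right $R$-module), or $R$ is a right self-injective (von Neumann) regular ring.
   Context: All rings are associative with identity and all modules are unital right modules. For a submodule $S$ of a module $M$, a complement of $S$ in $M$ is a submodule of $M$ maximal with respect to having zero intersection with $S$. A right module $M$ is called ADS if for every decomposition $M=S\oplus T$ and every complement $T'$ of $S$ in $M$ we have $M=S\oplus T'$. A ring is simple if it is nonzero and has no two-sided ideals other than $0$ and itself. $R$ is right self-injective if $R_R$ is an injective module. *)

(* Defs.v *)
From HB Require Import structures.
From mathcomp Require Import all_boot all_order all_algebra.
From mathcomp Require Import boolp classical_sets.

Set Implicit Arguments.
Unset Strict Implicit.
Unset Printing Implicit Defensive.

Import GRing.Theory.
Local Open Scope classical_set_scope.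
Local Open Scope ring_scope.

(* [lmodType] is the type of left modules, so right R-modules are modelled as
   left modules over the opposite ring R^c.  Rings are [pzRingType]s, which
   include the zero ring. *)
Notation rmodType R := (lmodType R^c).

Definition right_regular (R : pzRingType) : rmodType R := R^c^o.

Lemma right_regular_scaleE (R : pzRingType) (a : R^c) (x : right_regular R) :
  a *: x = (x : R) * (a : R).
Proof. by []. Qed.

Section RightModules.
Variables (R : pzRingType) (M : rmodType R).

Definition submodule (S : set M) : Prop := submod_closed (mem S).

Definition complement (S T : set M) : Prop :=
  [/\ submodule T, S `&` T = [set 0] &
      forall U : set M,
        submodule U -> S `&` U = [set 0] -> T `<=` U -> U = T].

Definition direct_decomposition (S T : set M) : Prop :=
  [/\ submodule S, submodule T, S `&` T = [set 0] &
      forall x : M, exists s t : M, [/\ S s, T t & x = s + t]].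

Definition ADS : Prop :=
  forall S T T' : set M,
    direct_decomposition S T -> complement S T' -> direct_decomposition S T'.

Definition indecomposable : Prop :=
  (exists x : M, x <> 0) /\
  forall S T : set M,
    direct_decomposition S T -> S = [set 0] \/ T = [set 0].

Definition injective_module : Prop :=
  forall (A B : rmodType R) (f : {linear A -> B}) (g : {linear A -> M}),
    injective f -> exists h : {linear B -> M}, forall a : A, h (f a) = g a.

End RightModules.

Section Rings.
Variable R : pzRingType.

Definition two_sided_ideal (I : set R) : Prop :=
  zmod_closed (mem I) /\
  forall r x : R, I x -> I (r * x) /\ I (x * r).

Definition simple_ring : Prop :=
  (1 : R) <> 0 /\
  forall I : set R, two_sided_ideal I -> I = [set 0] \/ I = setT.

Definition right_self_injective : Prop := injective_module (right_regular R).

Definition von_neumann_regular : Prop :=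
  forall a : R, exists x : R, a * x * a = a.

End Rings.

Arguments ADS {R} M.
Arguments indecomposable {R} M.
Arguments injective_module {R} M.

(* Main.v *)
Require Import Defs.
From mathcomp Require Import all_boot all_order all_algebra.
From mathcomp Require Import boolp classical_sets.
From HB Require Import structures.

(** The ring R has a nontrivial idempotent e as soon as [R_R] decomposes; put
    f = 1 - e.  The ADS condition applied to R = fR + eR says that fR and eR
    are injective relative to each other: the graph of a map from a submodule
    of eR to fR meets fR trivially, hence lies in a complement of fR, and that
    complement is the graph of an extension ([ADS_graph_left_mult]).

    Simplicity turns relative injectivity into injectivity.  Let W be the graph
    of a maximal partial map from a module B to fR.  Relative injectivity
    forces its domain to contain y e for every y in B, and the r such that B r
    lies in the domain form a two-sided ideal containing e; since this ideal is
    all of R, W is defined everywhere ([simple_extend_into_summand]).  By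
    symmetry eR is injective too, and so is R = eR + fR.

    Finally, a simple ring has zero right singular ideal, and regularity is the
    usual consequence: for K a complement of the right annihilator N of a, the
    map a k |-> k on a K extends to left multiplication by some b, so
    a b a - a kills the essential right ideal N + K and therefore vanishes.

    Partial homomorphisms B -> M are handled as submodules of B * M (or of
    R = eR + fR, for maps eR -> fR) that meet M trivially, so that maximal
    extensions come from complements of M and one application of Zorn's lemma,
    [complement_containing], serves everywhere. *)

Set Implicit Arguments.
Unset Strict Implicit.
Unset Printing Implicit Defensive.

Import GRing.Theory.
Local Open Scope classical_set_scope.
Local Open Scope ring_scope.

(** * Submodules and complements *)

Section Submodules.
Variables (R : pzRingType) (M : rmodType R).
Implicit Types (S T U : set M) (x y : M) (a r : R^c).

Lemma submoduleP S :
  submodule S <-> S 0 /\ forall a x y, S x -> S y -> S (a *: x + y).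
Proof.
split=> [[S0 SD]|[S0 SD]].
  split=> [|a x y Sx Sy]; first exact: set_mem S0.
  by apply/set_mem/SD; apply/mem_set.
by split=> [|a x y /set_mem Sx /set_mem Sy]; apply/mem_set => //; exact: SD.
Qed.

Lemma submodule0 S : submodule S -> S 0.
Proof. by move/submoduleP => []. Qed.

Lemma submoduleZ S a x : submodule S -> S x -> S (a *: x).
Proof.
by move/submoduleP => [S0 SD] Sx; rewrite -[_ *: _]addr0; exact: SD.
Qed.

Lemma submoduleD S x y : submodule S -> S x -> S y -> S (x + y).
Proof. by move/submoduleP => [_ SD] Sx Sy; rewrite -[x]scale1r; exact: SD. Qed.

Lemma submoduleB S x y : submodule S -> S x -> S y -> S (x - y).
Proof.
by move/submoduleP => [_ SD] Sx Sy; rewrite addrC -scaleN1r; exact: SD.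
Qed.

Lemma disjointP S T : submodule S -> submodule T ->
  S `&` T = [set 0] <-> forall x, S x -> T x -> x = 0.
Proof.
move=> mS mT; split=> [ST x Sx Tx|ST].
  by have : (S `&` T) x by []; rewrite ST.
by apply/seteqP; split=> [x [/ST]//|_ ->]; split; exact: submodule0.
Qed.

(** Zorn's lemma on the submodules containing C and disjoint from S; maximality
    among those is maximality among all submodules disjoint from S. *)
Lemma complement_containing S C :
  submodule S -> submodule C -> S `&` C = [set 0] ->
  exists2 T, complement S T & C `<=` T.
Proof.
move=> mS mC SC.
(* Stating the property of [C `|` U] rather than [U] makes it hold for the
   union of the empty chain. *)
pose P U := submodule (C `|` U) /\ S `&` (C `|` U) = [set 0].
have [F FP Ftot|T [[mT ST] Tmax]] := @Zorn_bigcup M P.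
  have common x y : (C `|` \bigcup_(X in F) X) x ->
      (C `|` \bigcup_(X in F) X) y ->
      exists X, [/\ P X, (C `|` X) x, (C `|` X) y &
                    X `<=` \bigcup_(X in F) X].
    move=> [Cx|[X FX Xx]] [Cy|[Y FY Yy]].
    - exists set0; split; [|by left|by left|by []].
      by rewrite /P setU0.
    - exists Y; split; [exact: FP|by left|by right|exact: bigcup_sup].
    - exists X; split; [exact: FP|by right|by left|exact: bigcup_sup].
    - have [XY|YX] := Ftot _ _ FX FY.
        exists Y; split; [exact: FP|right; exact: XY|by right|].
        exact: bigcup_sup.
      exists X; split; [exact: FP|by right|right; exact: YX|].
      exact: bigcup_sup.
  have mU : submodule (C `|` \bigcup_(X in F) X).
    apply/submoduleP; split=> [|a x y Ux Uy]; first by left; exact: submodule0.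
    have [X [[mX _] Xx Xy XU]] := common _ _ Ux Uy.
    have [_ /(_ a x y Xx Xy)[|/XU]] := (submoduleP _).1 mX; first by left.
    by right.
  split=> //; apply/disjointP => // x Sx Ux.
  have [X [[mX SX] Xx _ _]] := common _ _ Ux Ux.
  exact: (disjointP mS mX).1.
exists (C `|` T); last by move=> x; left.
split=> // U mU SU TU; apply/seteqP; split=> // x Ux.
have CUU : C `|` U = U.
  by apply/setUidPr => z Cz; apply: TU; left.
apply: contrapT => nTx; apply: (Tmax U).
  split=> [|UT]; last by apply: nTx; right; exact: UT.
  by move=> z Tz; apply: TU; right.
by rewrite /P CUU.
Qed.

(** Maximality of T read elementwise: T + yR contains T, so it equals T as soon
    as it is disjoint from S. *)
Lemma complement_absorbs S T y :
  submodule S -> complement S T ->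
  (forall t r, T t -> S (t + r *: y) -> t + r *: y = 0) -> T y.
Proof.
move=> mS [mT ST Tmax] Sy.
pose U := [set x | exists t r, T t /\ x = t + r *: y].
have mU : submodule U.
  apply/submoduleP; split.
    by exists 0, 0; split; [exact: submodule0|rewrite scale0r addr0].
  move=> a _ _ [t [r [Tt ->]]] [t' [r' [Tt' ->]]].
  exists (a *: t + t'), (a * r + r'); split.
    by apply: submoduleD => //; exact: submoduleZ.
  by rewrite scalerDr scalerDl scalerA addrACA.
have <- : U = T.
  apply: Tmax => //.
    by apply/disjointP => // x Sx [t [r [Tt xE]]]; rewrite xE; apply: Sy => //;
      rewrite -xE.
  by move=> t Tt; exists t, 0; rewrite scale0r addr0.
by exists 0, 1; rewrite scale1r add0r; split=> //; exact: submodule0.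
Qed.

(** S + T is essential: if yR missed S + T then T + yR would still be disjoint
    from S, and maximality would put y in T. *)
Lemma complement_sum_essential S T y :
  submodule S -> complement S T -> y <> 0 ->
  exists r s t, [/\ S s, T t, r *: y = s + t & r *: y <> 0].
Proof.
move=> mS cT y0; apply: contrapT => no_mult.
have [mT ST _] := cT.
have yR0 r s t : S s -> T t -> r *: y = s + t -> r *: y = 0.
  move=> Ss Tt E; apply: contrapT => ry0.
  by apply: no_mult; exists r, s, t.
have Ty : T y.
  apply: complement_absorbs cT _ => // t r Tt Sty.
  have ry0 : r *: y = 0.
    apply: (yR0 r (t + r *: y) (- t)) => //; last by rewrite addrC addKr.
    by rewrite -sub0r; apply: submoduleB => //; exact: submodule0.
  by move: Sty; rewrite ry0 addr0 => St; exact: (disjointP mS mT).1.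
apply: y0; rewrite -[y]scale1r; apply: (yR0 1 0 y) => //.
  exact: submodule0.
by rewrite scale1r add0r.
Qed.

End Submodules.

(** * Injectivity in terms of graphs *)

(** Partial homomorphisms B -> M with arbitrary domain are encoded by their
    graphs; this covers maps on submodules without forming subtypes. *)
Definition graph_injective (R : pzRingType) (M : rmodType R) : Prop :=
  forall (B : rmodType R) (G : set (B * M)%type),
    submodule G -> (forall n, G (0, n) -> n = 0) ->
    exists h : {linear B -> M}, forall x n, G (x, n) -> h x = n.

Lemma graph_injective_injective (R : pzRingType) (M : rmodType R) :
  graph_injective M -> injective_module M.
Proof.
move=> Minj A B f g f_inj.
have [|n [a [/= fa0 ->]]|h hG] :=
  Minj B [set p | exists a, p.1 = f a /\ p.2 = g a].
- apply/submoduleP; split; first by exists 0; rewrite !linear0.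
  move=> r [x m] [y n] [a /= [-> ->]] [b /= [-> ->]].
  by exists (r *: a + b); rewrite !linearP.
- by rewrite (f_inj a 0) linear0.
by exists h => a; apply: hG; exists a.
Qed.

(** * Regularity of nonsingular self-injective rings *)

Definition right_annihilator (R : pzRingType) (a : R) :
  set (right_regular R) :=
  [set x | a * (x : R) = 0].

Lemma submodule_right_annihilator (R : pzRingType) (a : R) :
  submodule (right_annihilator a).
Proof.
apply/submoduleP; rewrite /right_annihilator.
split=> [|r x y] /=; rewrite ?mulr0// => ax ay.
by rewrite mulrDr ay addr0 right_regular_scaleE mulrA ax mul0r.
Qed.

(** The right annihilator of a is essential: every nonzero right ideal yR
    meets it. *)
Definition right_singular (R : pzRingType) (a : R) : Prop :=
  forall y : R, y <> 0 -> exists r : R, y * r <> 0 /\ a * (y * r) = 0.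

(** Essentiality passes from the annihilator of a to that of a r because the
    preimage of an essential right ideal under left multiplication by r is
    essential: if r y = 0 then y already lies in it, and otherwise a multiple of
    r y lands in the annihilator of a. *)
Lemma right_singular_ideal (R : pzRingType) :
  two_sided_ideal [set a : R | right_singular a].
Proof.
split; first split.
- by apply/mem_set => y y0; exists 1; rewrite mulr1 mul0r.
- move=> a b /set_mem Za /set_mem Zb; apply/mem_set => y /Za[r [yr0 ayr]].
  have [s [yrs0 byrs]] := Zb _ yr0.
  by exists (r * s); rewrite mulrA mulrBl byrs mulrA ayr mul0r subr0.
move=> r a Za; split=> y y0.
  by have [s [ys0 ays]] := Za y y0; exists s; rewrite -mulrA ays mulr0.
have [ry0|ry0] := pselect (r * y = 0).
  by exists 1; rewrite mulr1 -mulrA ry0 mulr0.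
have [s [rys0 arys]] := Za _ ry0.
exists s; split; last by rewrite -mulrA (mulrA r).
by move=> ys0; apply: rys0; rewrite -mulrA ys0 mulr0.
Qed.

(** The singular ideal is proper because 1 has zero annihilator. *)
Lemma simple_right_nonsingular (R : pzRingType) (a : R) :
  simple_ring R -> right_singular a -> a = 0.
Proof.
move=> [one0 simpleR] Za.
have [Z0|ZT] := simpleR _ (@right_singular_ideal R).
  by have : [set a : R | right_singular a] a by []; rewrite Z0.
have : [set a : R | right_singular a] 1 by rewrite ZT.
by move=> /(_ 1 one0)[r []]; rewrite !mul1r.
Qed.

(** A quasi-inverse of a is obtained by inverting a where it is injective,
    namely on a complement K of its annihilator N. *)
Lemma graph_injective_regular (R : pzRingType) :
  (forall a : R, right_singular a -> a = 0) ->
  graph_injective (right_regular R) -> von_neumann_regular R.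
Proof.
move=> nonsing Rinj a.
pose N := right_annihilator a.
have mN : submodule N := submodule_right_annihilator a.
have [||K cK _] := @complement_containing _ _ N [set 0] mN.
- apply/submoduleP; split=> // r x y -> ->.
  by rewrite scaler0 addr0.
- by apply/setIidPr => _ ->; exact: submodule0.
have [mK NK _] := cK.
pose G := [set p : right_regular R * right_regular R |
             K p.2 /\ p.1 = a * (p.2 : R)].
have [||h hG] := Rinj _ G.
- apply/submoduleP; split; first by split; [exact: submodule0|rewrite mulr0].
  move=> r [x k] [y l] [/= Kk ->] [/= Kl ->]; split=> /=.
    by apply: submoduleD => //; exact: submoduleZ.
  by rewrite mulrDr !right_regular_scaleE mulrA.
- by move=> k [/= Kk ak0]; apply: (disjointP mN mK).1.
pose one : right_regular R := (1 : R).
pose b : R := h one.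
have hE (x : R) : h x = b * x.
  transitivity (h ((x : R^c) *: one)); last exact: linearZ.
  by rewrite right_regular_scaleE mul1r.
have bE (k : R) : K k -> b * (a * k) = k by move=> Kk; rewrite -hE; exact: hG.
exists b; apply/eqP; rewrite -subr_eq0; apply/eqP/nonsing => y y0.
have [r [s [t [Ns Kt E ry0]]]] := complement_sum_essential mN cK y0.
exists r; split=> //.
rewrite (_ : y * r = (s : R) + (t : R)) // mulrDr.
have -> : (a * b * a - a) * s = 0 by rewrite mulrBl -!mulrA Ns !mulr0 subr0.
by rewrite add0r mulrBl -!mulrA bE // subrr.
Qed.

(** * From ADS to self-injectivity *)

Definition complementary_idempotents (R : pzRingType) (e f : R) : Prop :=
  [/\ e + f = 1, e * f = 0 & f * e = 0].

Lemma complementary_idempotentsC (R : pzRingType) (e f : R) :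
  complementary_idempotents e f -> complementary_idempotents f e.
Proof. by case=> ef1 ef0 fe0; split; rewrite // addrC. Qed.

Lemma complementary_idempotents_idem (R : pzRingType) (e f : R) :
  complementary_idempotents e f -> e * e = e.
Proof. by case=> ef1 ef0 _; rewrite -[RHS]mulr1 -ef1 mulrDr ef0 addr0. Qed.

(** With e + f = 1, the right annihilator of e is fR and that of f is eR, so
    this is R = fR + eR. *)
Lemma idempotent_decomposition (R : pzRingType) (e f : R) :
  complementary_idempotents e f ->
  direct_decomposition (right_annihilator e) (right_annihilator f).
Proof.
move=> [ef1 ef0 fe0]; split; try exact: submodule_right_annihilator.
  apply/disjointP; try exact: submodule_right_annihilator.
  move=> x ex fx; have : (e + f) * (x : R) = 0 by rewrite mulrDl ex fx addr0.
  by rewrite ef1 mul1r.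
move=> x; exists (f * (x : R)), (e * (x : R)); split.
- by rewrite /right_annihilator /= mulrA ef0 mul0r.
- by rewrite /right_annihilator /= mulrA fe0 mul0r.
transitivity ((e + f) * (x : R)); first by rewrite ef1 mul1r.
by rewrite mulrDl; exact: addrC.
Qed.

(** Relative injectivity of fR with respect to eR: a submodule C of R = eR + fR
    that meets fR trivially is the graph of a map from a submodule of eR to fR.
    Writing e = s + t along fR + T, for a complement T of fR containing C,
    this map is left multiplication by - s. *)
Lemma ADS_graph_left_mult (R : pzRingType) (e f : R)
    (C : set (right_regular R)) :
  ADS (right_regular R) -> complementary_idempotents e f ->
  submodule C -> right_annihilator e `&` C = [set 0] ->
  exists b : R, e * b = 0 /\ forall c : R, C c -> f * c = b * (e * c).
Proof.
move=> adsR idem mC eC.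
have [T cT CT] := complement_containing (submodule_right_annihilator e) mC eC.
have [_ mT eT all_sum] := adsR _ _ _ (idempotent_decomposition idem) cT.
have [s [t [es Tt eE]]] :
  exists s t : R, [/\ e * s = 0, T t & e = s + t] := all_sum e.
have [ef1 ef0 _] := idem.
exists (- s); split; first by rewrite mulrN es oppr0.
move=> c Cc.
(* Both c and t (e c) lie in T, so this difference lies in T and in fR. *)
have cE : c - t * (e * c) = f * c + s * (e * c) :> R.
  have -> : t = e - s :> R by rewrite eE addrC addKr.
  rewrite mulrBl mulrA (complementary_idempotents_idem idem) opprB addrA.
  by rewrite addrAC -{1}[c]mul1r -ef1 mulrDl (addrC (e * c)) addrK.
apply/eqP; rewrite mulNr -addr_eq0; apply/eqP.
apply: (disjointP (submodule_right_annihilator e) mT).1 => //.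
  by rewrite /right_annihilator /= mulrDr !mulrA ef0 es !mul0r addr0.
rewrite -cE; apply: (submoduleB mT); first exact: CT.
exact: (submoduleZ (e * c : R^c) mT Tt).
Qed.

(** fR is injective over a simple ring.  W is a complement of 0 * fR in B * R
    containing the given graph; the pairs of W with second component in fR form
    the graph of a maximal extension, whose domain is D.  Relative injectivity
    is applied to the maps e r |-> y (e r) from eR to B to get B e inside D; the
    step from B e to B is where simplicity enters. *)
Lemma simple_extend_into_summand (R : pzRingType) (e f : R) :
  simple_ring R -> ADS (right_regular R) ->
  complementary_idempotents e f -> e <> 0 ->
  forall (B : rmodType R) (G : set (B * right_regular R)%type),
    submodule G -> (forall n, G (0, n) -> n = 0) ->
    (forall x n, G (x, n) -> e * n = 0) ->
    exists h : {linear B -> right_regular R}, forall x n, G (x, n) -> h x = n.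
Proof.
move=> [_ simpleR] adsR idem e0 B G mG G0 Ge.
have [ef1 ef0 fe0] := idem.
have ee : e * e = e := complementary_idempotents_idem idem.
pose S0 := [set p : B * right_regular R | p.1 = 0 /\ e * (p.2 : R) = 0].
have mS0 : submodule S0.
  apply/submoduleP; split; first by split; rewrite ?mulr0.
  move=> r [x m] [y n] [/= -> em] [/= -> en]; split=> /=.
    by rewrite scaler0 addr0.
  by rewrite mulrDr en addr0 right_regular_scaleE mulrA em mul0r.
have [|W cW GW] := complement_containing mS0 mG.
  by apply/disjointP => // -[x n] [/= -> _] /G0 ->.
have [mW SW _] := cW.
have W0 n : W (0, n) -> e * n = 0 -> n = 0.
  move=> Wn en; have /(_ (0, n)) := (disjointP mS0 mW).1 SW.
  by move=> /(_ (conj erefl en) Wn)[].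
pose D := [set x | exists n, e * n = 0 /\ W (x, n)].
have mD : submodule D.
  apply/submoduleP; split.
    by exists 0; rewrite mulr0; split=> //; exact: (submodule0 mW).
  move=> r x y [m [em Wm]] [n [en Wn]].
  exists (r *: (m : right_regular R) + n); split.
    by rewrite mulrDr en addr0 right_regular_scaleE mulrA em mul0r.
  have [_ Wlin] := (submoduleP _).1 mW.
  exact: (Wlin r (x, m) (y, n)).
have De y : D ((e : R^c) *: y).
  (* C is the graph of the map that W induces on a submodule of eR through
     e r |-> y (e r). *)
  pose C := [set c : right_regular R |
               W ((e * (c : R) : R^c) *: y, f * (c : R))].
  have mC : submodule C.
    have [W00 Wlin] := (submoduleP _).1 mW.
    apply/submoduleP; split; first by rewrite /C /= !mulr0 scale0r.
    move=> r c d Cc Cd; have := Wlin r _ _ Cc Cd; rewrite /C /=.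
    congr W; congr pair => /=.
      by rewrite mulrDr scalerDl right_regular_scaleE mulrA scalerA.
    by rewrite mulrDr !right_regular_scaleE mulrA.
  have [|b [eb bC]] := ADS_graph_left_mult adsR idem mC.
    apply/disjointP => //; first exact: submodule_right_annihilator.
    move=> c ec; rewrite /C /= ec scale0r => /W0.
    rewrite mulrA ef0 mul0r => /(_ erefl) fc.
    have : (e + f) * (c : R) = 0 by rewrite mulrDl ec fc addr0.
    by rewrite ef1 mul1r.
  (* The extension must send y e to b e, not b, since r and e r give the same
     multiple of y e. *)
  exists (b * e); split; first by rewrite mulrA eb mul0r.
  apply: complement_absorbs cW _ => // -[w1 w2] r Ww [/= w10 en].
  set n : R := w2 + _ in en *.
  have nE : n = w2 + b * e * r by [].
  have w1E : w1 = - ((e * r : R) : R^c) *: y.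
    by apply/eqP; rewrite scaleNr -addr_eq0 -w10 scalerA.
  (* c has eR-component - e r and fR-component n - b e r = w2, so it lies in
     the graph C, and b determines its fR-component: n = 0. *)
  pose c : R := n - b * (e * r) - e * r.
  have ec : e * c = - (e * r).
    by rewrite /c !mulrBr en !mulrA eb ee !mul0r subr0 sub0r.
  have fc : f * c = n - b * (e * r).
    have -> : f = 1 - e by rewrite -ef1 addrC addKr.
    by rewrite mulrBl mul1r ec opprK /c subrK.
  have Cc : C c.
    by rewrite /C /= ec fc nE -mulrA addrK -w1E.
  have := bC c Cc; rewrite ec fc mulrN => /eqP.
  rewrite subr_eq addNr => /eqP n0.
  exact: (congr2 pair w10 n0).
pose I := [set r : R | forall x : B, D ((r : R^c) *: x)].
have ideal_I : two_sided_ideal I.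
  split; first split.
  - by apply/mem_set => x; rewrite scale0r; exact: submodule0.
  - move=> r s /set_mem Ir /set_mem Is; apply/mem_set => x.
    by rewrite scalerBl; apply: submoduleB; [exact: mD|exact: Ir|exact: Is].
  move=> r s Is; split=> x.
    by have := Is ((r : R^c) *: x); rewrite scalerA.
  by have := submoduleZ (r : R^c) mD (Is x); rewrite scalerA.
have Dall x : D x.
  have [I0|IT] := simpleR I ideal_I.
    by case: e0; have : I e by []; rewrite I0.
  have : I 1 by rewrite IT.
  by move=> /(_ x); rewrite scale1r.
have [h hW] := choice Dall.
have Weq x m n : e * m = 0 -> e * n = 0 -> W (x, m) -> W (x, n) -> m = n.
  move=> em en Wm Wn; apply/eqP; rewrite -subr_eq0; apply/eqP/W0.
    by have := submoduleB mW Wm Wn; congr W; congr pair; exact: subrr.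
  by rewrite mulrBr em en subr0.
have h_lin : linear (h : B -> right_regular R).
  move=> r x y; have [ex Wx] := hW x; have [ey Wy] := hW y.
  have [exy Wxy] := hW (r *: x + y).
  apply: Weq Wxy _ => //.
    by rewrite mulrDr ey addr0 right_regular_scaleE mulrA ex mul0r.
  have [_ Wlin] := (submoduleP _).1 mW.
  exact: (Wlin r _ _ Wx Wy).
pose hL := GRing.isLinear.Build R^c B (right_regular R) *:%R
  (h : B -> right_regular R) h_lin.
pose h' : {linear B -> right_regular R} :=
  HB.pack (h : B -> right_regular R) hL.
exists h' => x n Gxn; have [eh Wh] := hW x.
by apply: (Weq x) => //; [exact: Ge Gxn|exact: GW].
Qed.

Lemma simple_ADS_graph_injective (R : pzRingType) (e f : R) :
  simple_ring R -> ADS (right_regular R) ->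
  complementary_idempotents e f -> e <> 0 -> f <> 0 ->
  graph_injective (right_regular R).
Proof.
move=> simpleR adsR idem e0 f0 B G mG G0.
have component (u v : R) : complementary_idempotents u v -> u <> 0 ->
    exists h : {linear B -> right_regular R},
      forall x n, G (x, n) -> h x = v * n.
  move=> uv u0; have [_ uv0 _] := uv.
  (* The composite of the partial map with graph G and the projection of R
     onto vR, which is the right annihilator of u. *)
  pose H := [set p : B * right_regular R |
               exists n : R, G (p.1, n) /\ p.2 = v * n].
  have [|n [m [/= /G0 -> ->]]|x n [m [_ /= ->]]|h hH] :=
    simple_extend_into_summand simpleR adsR uv u0 (G := H).
  - have [G00 Glin] := (submoduleP _).1 mG.
    apply/submoduleP; split; first by exists 0; rewrite mulr0.
    move=> r [x m] [y n] [m' /= [Gm ->]] [n' /= [Gn ->]].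
    exists (r *: (m' : right_regular R) + n'); split.
      exact: (Glin r _ _ Gm Gn).
    by rewrite mulrDr !right_regular_scaleE mulrA.
  - by rewrite mulr0.
  - by rewrite mulrA uv0 mul0r.
  by exists h => x n Gxn; apply: hH; exists n.
have [h hf] := component _ _ idem e0.
have [k ke] := component _ _ (complementary_idempotentsC idem) f0.
have [ef1 _ _] := idem.
exists (h \+ k : {linear B -> right_regular R}) => x n Gxn /=.
rewrite (hf _ _ Gxn) (ke _ _ Gxn).
transitivity ((e + f) * (n : R)); last by rewrite ef1 mul1r.
by rewrite mulrDl; exact: addrC.
Qed.

(** The idempotents are the components of 1 in a nontrivial decomposition. *)
Lemma decomposable_idempotents (R : pzRingType) :
  (1 : R) <> 0 -> ~ indecomposable (right_regular R) ->
  exists e f : R, [/\ complementary_idempotents e f, e <> 0 & f <> 0].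
Proof.
move=> one0 decR; apply: contrapT => no_idem; apply: decR; split.
  by exists (1 : R).
move=> S T [mS mT ST all_sum].
have [e [f [Se Tf ef]]] :
  exists e f : R, [/\ S e, T f & 1 = e + f] := all_sum (1 : R).
have rS (x r : R) : S x -> S (x * r) by exact: (submoduleZ (r : R^c) mS).
have rT (x r : R) : T x -> T (x * r) by exact: (submoduleZ (r : R^c) mT).
have ST0 := (disjointP mS mT).1 ST.
have ef1 : e + f = 1 by rewrite -ef.
have fe0 : f * e = 0.
  have E : f * e = e - e * e.
    by rewrite -{2}[e]mul1r -ef1 mulrDl addrC addKr.
  apply: ST0; last exact: rT.
  by rewrite E; apply: (submoduleB mS) => //; exact: rS.
have ef0 : e * f = 0.
  have E : e * f = f - f * f.
    by rewrite -{2}[f]mul1r -ef1 mulrDl addrK.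
  apply: ST0; first exact: rS.
  by rewrite E; apply: (submoduleB mT) => //; exact: rT.
have [e0|e0] := pselect (e = 0).
  left; apply/seteqP; split=> [x Sx|_ ->]; last exact: submodule0.
  have xE : f * (x : R) = x by rewrite -[f]add0r -e0 ef1 mul1r.
  by apply: ST0 => //; rewrite -xE; exact: rT.
have [f0|f0] := pselect (f = 0).
  right; apply/seteqP; split=> [x Tx|_ ->]; last exact: submodule0.
  have xE : e * (x : R) = x by rewrite -[e]addr0 -f0 ef1 mul1r.
  by apply: ST0 => //; rewrite -xE; exact: rS.
by case: no_idem; exists e, f.
Qed.

Theorem theorem3p9 (R : pzRingType) :
  simple_ring R ->
  ADS (right_regular R) ->
  indecomposable (right_regular R) \/
  (right_self_injective R /\ von_neumann_regular R).
Proof.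
move=> simpleR adsR.
have [indec|dec] := pselect (indecomposable (right_regular R)); first by left.
right; have [e [f [idem e0 f0]]] := decomposable_idempotents simpleR.1 dec.
have Rinj := simple_ADS_graph_injective simpleR adsR idem e0 f0.
split; first exact: graph_injective_injective.
by apply: graph_injective_regular => // a; exact: simple_right_nonsingular.
Qed.
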